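(* Let $n\ge 2$ and let $W$ be the Coxeter group of type $C_n$ with generators $S=\{s_1,\ldots,s_n\}$, whose Coxeter graph $\Gamma_{C_n}$ is the path $s_1 - s_2 - \cdots - s_n$. Let $v\in W$, and partition the vertex set of the induced subgraph $\Gamma_{C_n}[S\setminus\mathrm{Des}(v)]$ into its connected components $b_1,\ldots,b_k$. Then the number of Boolean intervals $[v,w]$ in the right weak order of $W$ with minimal element $v$ and arbitrary maximal element $w$ (including $w=v$) equals $$\prod_{i=1}^k F_{|b_i|+2},$$ where $F_\ell$ is the $\ell$-th Fibonacci number with $F_1=F_2=1$ (an empty product is $1$).
   Context: Type $C_n$: Coxeter matrix $m(s_i,s_i)=1$, $m(s_i,s_{i+1})=3$ for $1\le i\le n-2$, $m(s_{n-1},s_n)=4$, and $m(s_i,s_j)=2$ if $|i-j|>1$. Equivalently, $C_n$ is realized as the group of permutations $\pi\in\mathfrak S_{2n}$ with $\pi_i=k$ iff $\pi_{2n-i+1}=2n-k+1$, where $s_i$ ($i\in[n]$) is in $\mathrm{Des}(v)$ iff $\pi_i>\pi_{i+1}$. The right weak order: $u\le w$ iff $\ell(w)=\ell(u)+\ell(u^{-1}w)$. $\mathrm{Des}(v)=\{s\in S:\ell(vs)<\ell(v)\}$. An interval is Boolean if it is isomorphic to the lattice of subsets of a finite set. *)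

(* Defs.v *)
From mathcomp Require Import all_boot.
From mathcomp Require Import boolp classical_sets functions cardinality.

Set Implicit Arguments.
Unset Strict Implicit.
Unset Printing Implicit Defensive.

Local Open Scope group_scope.

Section Coxeter.
Variables (I : finType) (m : I -> I -> nat).

(* The entry infinity of a Coxeter matrix is encoded by 0: x ^+ 0 = 1 is a
   vacuous relation. *)
Definition coxeter_relations (G : groupType) (s : I -> G) : Prop :=
  forall i j, (s i * s j) ^+ m i j = 1.

(* W = < s i | (s i * s j) ^+ m i j = 1 >, the presentation being expressed by
   its universal property.  As m i i = 1 in a Coxeter matrix, the generators
   are involutions and words need no inverses. *)
Definition coxeter_system (W : groupType) (s : I -> W) : Prop :=
  [/\ coxeter_relations s,
      forall w : W, exists e : seq I, w = \prod_(i <- e) s i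
    & forall (H : groupType) (f : I -> H), coxeter_relations f ->
        exists phi : {multiplicative W -> H}, forall i, phi (s i) = f i].

(* m i j != 2 means 3 <= m i j or m i j = infinity (encoded by 0). *)
Definition coxeter_edge : rel I := fun i j => (i != j) && (m i j != 2).

Definition induced_edge (A : {set I}) : rel I :=
  fun i j => [&& i \in A, j \in A & coxeter_edge i j].

Definition induced_components (A : {set I}) : {set {set I}} :=
  equivalence_partition (connect (induced_edge A)) A.

End Coxeter.

Section WeakOrder.
Variables (I : finType) (W : groupType) (s : I -> W).

Definition has_expr_of_size (w : W) (k : nat) : Prop :=
  exists e : seq I, size e = k /\ w = \prod_(i <- e) s i.

(* The default value 0 is irrelevant when s generates W as a monoid. *)
Definition coxeter_length (w : W) : nat :=
  xget 0 (mkset (fun k => has_expr_of_size w k /\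
                          forall j, has_expr_of_size w j -> (k <= j)%N)).

Definition weak_le (u w : W) : Prop :=
  coxeter_length w = (coxeter_length u + coxeter_length (u^-1 * w))%N.

Definition weak_interval (v w : W) : set W :=
  mkset (fun x => weak_le v x /\ weak_le x w).

Definition descents (v : W) : {set I} :=
  [set i | (coxeter_length (v * s i)%g < coxeter_length v)%N]%SET.

Definition is_boolean (X : set W) : Prop :=
  exists (T : finType) (f : {set T} -> W),
    set_bij setT X f /\
    forall A B : {set T}, A \subset B <-> weak_le (f A) (f B).

Definition boolean_intervals_from (v : W) : set (set W) :=
  mkset (fun X => exists w, [/\ weak_le v w, X = weak_interval v w
                              & is_boolean X]).

End WeakOrder.

Local Close Scope group_scope.

(* The index i : 'I_n stands for the generator s_(i+1). *)
Definition coxeter_matrix_C (n : nat) (i j : 'I_n) : nat :=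
  if i == j then 1
  else if (i.+1 == j :> nat) || (j.+1 == i :> nat)
       then (if maxn i j == n.-1 then 4 else 3)
  else 2.

Fixpoint fib (n : nat) : nat :=
  match n with
  | 0 => 0
  | 1 => 1
  | (n'.+1 as p).+1 => fib p + fib n'
  end.

(* Main.v *)
(* A Boolean interval [v, w] is determined by its atoms v s with s in some set J
   of generators: J consists of ascents of v, any two of which commute because
   they have a join two levels above v, and then w = v * prod J.  Conversely every
   set J of pairwise commuting ascents gives such an interval.  The facts about
   length follow from the exchange property, which is obtained by extending
   s_i |-> (s_i, [x = s_i]) to a morphism from W to a semidirect product: its
   second component records the inversions of an element.  In type C,
   commutation is non-adjacency, as seen in the signed permutation group, so the
   intervals correspond to the independent subsets of S \ Des(v) in a path; these
   are counted one connected component at a time. *)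
Require Import Defs.
From HB Require Import structures.
From mathcomp Require Import all_boot.
From mathcomp Require Import fingroup perm.
From mathcomp Require Import boolp classical_sets functions cardinality.
(* Again last, so that the lemmas on finite sets shadow those on classical sets. *)
From mathcomp Require Import fintype finset.
From mathcomp Require Import zify.

Set Implicit Arguments.
Unset Strict Implicit.
Unset Printing Implicit Defensive.

Local Open Scope group_scope.

(* Semidirect product of [W] with the group of functions [W -> bool] under
   [addb], on which [W] acts by conjugating the argument. *)
Definition twisted (W : groupType) : Type := (W * (W -> bool))%type.

Section Twisted.
Variable W : groupType.
Implicit Types a b c : twisted W.

Definition twisted_one : twisted W := (1, fun=> false).
Definition twisted_inv a : twisted W := (a.1^-1, fun x => a.2 (x ^ a.1^-1)).
Definition twisted_mul a b : twisted W :=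
  (a.1 * b.1, fun x => a.2 x (+) b.2 (x ^ a.1)).

Lemma twisted_mulA : associative twisted_mul.
Proof.
move=> a b c; congr pair; first exact: mulgA.
by apply/funext => x /=; rewrite conjgM addbA.
Qed.

Lemma twisted_mul1 : left_id twisted_one twisted_mul.
Proof.
case=> w f; congr pair; first exact: mul1g.
by apply/funext => x /=; rewrite conjg1.
Qed.

Lemma twisted_1mul : right_id twisted_one twisted_mul.
Proof.
case=> w f; congr pair; first exact: mulg1.
by apply/funext => x /=; rewrite addbF.
Qed.

Lemma twisted_mulV : left_inverse twisted_one twisted_inv twisted_mul.
Proof.
case=> w f; congr pair; first exact: mulVg.
by apply/funext => x /=; rewrite addbb.
Qed.

Lemma twisted_Vmul : right_inverse twisted_one twisted_inv twisted_mul.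
Proof.
case=> w f; congr pair; first exact: mulgV.
by apply/funext => x /=; rewrite conjgK addbb.
Qed.

HB.instance Definition _ := Choice.on (twisted W).
HB.instance Definition _ := isGroup.Build (twisted W)
  twisted_mulA twisted_mul1 twisted_1mul twisted_mulV twisted_Vmul.

End Twisted.

(** * The inversion cocycle, the length function and the exchange property *)

Section Exchange.
Variables (I : finType) (m : I -> I -> nat) (W : groupType) (s : I -> W).
Hypotheses (m_diag : forall i, m i i = 1%N) (hW : coxeter_system m s).

Lemma gen_sq i : s i * s i = 1.
Proof. by have [/(_ i i)] := hW; rewrite m_diag expg1. Qed.

Lemma gen_inv i : (s i)^-1 = s i.
Proof. exact/mulg1_eq/gen_sq. Qed.

Lemma genK i : involutive ( *%g (s i)).
Proof. by move=> w; rewrite mulgA gen_sq mul1g. Qed.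

Definition twisted_gen i : twisted W := (s i, fun x => x == s i).

(** In the alternating word [s i * s j * s i * ...], conjugating the letter at position [h] (from 0)
    by the prefix before it gives the reflection [(s i * s j) ^+ h * s i]. *)
Lemma twisted_gen_mulX i j k :
  (twisted_gen i * twisted_gen j) ^+ k =
  ((s i * s j) ^+ k,
   fun x => odd (count (fun h => x == (s i * s j) ^+ h * s i) (iota 0 k.*2)))
  :> twisted W.
Proof.
set c := s i * s j.
have cVX h : s i * c ^- h = c ^+ h * s i.
  rewrite -expVgn invgM !gen_inv.
  elim: h => [|h IHh]; first by rewrite mulg1 mul1g.
  by rewrite (expgSr (s j * s i)) mulgA IHh (expgSr c) /c !mulgA.
elim: k => [|k IHk]; first by rewrite !expg0.
rewrite expgSr IHk; congr pair; first by rewrite expgSr.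
apply/funext => x; rewrite doubleS -addn2 iotaD count_cat oddD add0n /=.
congr addb; rewrite addn0 oddD !oddb.
have conjE y z : (y ^ (c ^+ k) == z) = (y == c ^+ k * z * c ^- k).
  by rewrite (can2_eq (conjgK _) (conjgKV _)) conjgE invgK mulgA.
have conjSE y z : (y ^ s i == z) = (y == s i * z * s i).
  by rewrite (can2_eq (conjgK _) (conjgKV _)) conjgE invgK gen_inv mulgA.
rewrite conjSE !conjE -mulgA cVX mulgA -expgnDr addnn; congr addb.
rewrite -!mulgA.
have -> : s i * (s j * (s i * c ^- k)) = c * c ^+ k * s i by rewrite cVX !mulgA.
by rewrite !mulgA -(mulgA _ (s i) (s j)) -expgSr -expgnDr addSn addnn.
Qed.

(* Since [(s i * s j) ^+ m i j = 1], the counted list runs twice through the same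
   [m i j] reflections, so every reflection is counted an even number of times. *)
Lemma twisted_gen_relations : coxeter_relations m twisted_gen.
Proof.
move=> i j; rewrite twisted_gen_mulX.
have [/(_ i j) cm _ _] := hW; rewrite cm; congr pair.
apply/funext => x /=; rewrite -addnn iotaD count_cat add0n.
rewrite -{2}[m i j]addn0 iotaDl count_map oddD.
under [in X in _ (+) X]eq_count => h do rewrite /= expgnDr cm mul1g.
by rewrite addbb.
Qed.

Lemma inversion_cocycle : exists N : W -> W -> bool,
  (forall x, N 1 x = false) /\
  forall i w x, N (s i * w) x = (x == s i) (+) N w (x ^ s i).
Proof.
have [_ gen /(_ _ _ twisted_gen_relations) [phi phiE]] := hW.
exists (fun w => (phi w).2); split=> [x|i w x]; last by rewrite gmulfM phiE.
have phi1 : phi 1 = 1 by apply: (mulgI (phi 1)); rewrite -gmulfM !mulg1.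
by rewrite phi1.
Qed.


Lemma gen_word (w : W) : exists e : seq I, w = \prod_(i <- e) s i.
Proof. by have [] := hW. Qed.

Local Notation len := (coxeter_length s).

(** Every element is a word, so the sizes of its expressions have a minimum and [xget] does not fall
    back on its default. *)
Lemma len_spec w : has_expr_of_size s w (len w) /\
  forall j, has_expr_of_size s w j -> len w <= j.
Proof.
have [e we] := gen_word w.
have ex : exists k, `[< has_expr_of_size s w k >].
  by exists (size e); apply/asboolP; exists e.
case: (ex_minnP ex) => k /asboolP wk kmin.
apply: (@xgetPex _ 0%N (mkset (fun k => has_expr_of_size s w k /\
  forall j, has_expr_of_size s w j -> k <= j))).
by exists k; split=> // j /asboolP/kmin.
Qed.

Lemma reduced_word w : exists2 e : seq I, size e = len w & w = \prod_(i <- e) s i.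
Proof. by have [[e [se we]] _] := len_spec w; exists e. Qed.

Lemma len_word (e : seq I) : len (\prod_(i <- e) s i) <= size e.
Proof. by have [_] := len_spec (\prod_(i <- e) s i); apply; exists e. Qed.

Lemma lenM x y : len (x * y) <= len x + len y.
Proof.
have [e <- ex] := reduced_word x; have [f <- fy] := reduced_word y.
by rewrite [x in len (x * _)]ex [y in len (_ * y)]fy -big_cat -size_cat len_word.
Qed.

Lemma len1 : len 1 = 0.
Proof. by have := len_word [::]; rewrite big_nil; case: (len 1). Qed.

Lemma len_eq0 w : (len w == 0) = (w == 1).
Proof.
apply/eqP/eqP => [|->]; last exact: len1.
by move=> w0; have [e + ->] := reduced_word w; rewrite w0 => /size0nil->; rewrite big_nil.
Qed.

Lemma word_inv (e : seq I) : (\prod_(i <- e) s i)^-1 = \prod_(i <- rev e) s i.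
Proof.
by rewrite -[in LHS](revK e) -prodgV; apply: eq_bigr => i _; rewrite gen_inv.
Qed.

Lemma lenV w : len w^-1 = len w.
Proof.
have le x : len x^-1 <= len x.
  by have [e <- ex] := reduced_word x; rewrite ex word_inv -size_rev len_word.
by apply/eqP; rewrite eqn_leq le -{1}[w]invgK le.
Qed.

Lemma len_gen i : len (s i) <= 1.
Proof. by have := len_word [:: i]; rewrite big_seq1. Qed.

(** Unfolding the cocycle along the word, [N] can hold at [x] only if [x] is some letter conjugated
    by the prefix before it; multiplying by [x] then deletes this letter. *)
Lemma strong_exchange (N : W -> W -> bool) :
    (forall x, N 1 x = false) ->
    (forall i w x, N (s i * w) x = (x == s i) (+) N w (x ^ s i)) ->
  forall (e : seq I) x, N (\prod_(i <- e) s i) x ->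
  exists2 e' : seq I, size e = (size e').+1 &
    x * \prod_(i <- e) s i = \prod_(i <- e') s i.
Proof.
move=> N1 NM; elim=> [|i e IHe] x; first by rewrite big_nil N1.
rewrite big_cons NM; have [-> _|_ /IHe[e' se' xe']] := eqVneq x (s i).
  by exists e; rewrite ?genK.
exists (i :: e'); rewrite /= ?se' // big_cons -xe' conjgE gen_inv.
by rewrite !mulgA gen_sq mul1g.
Qed.

(* [N w x] says that the reflection [x] is a left inversion of [w]. *)
Lemma left_inversions : exists N : W -> W -> bool,
 [/\ forall x, N 1 x = false,
     forall i w x, N (s i * w) x = (x == s i) (+) N w (x ^ s i)
   & forall i w, if N w (s i) then len w = (len (s i * w)).+1
                 else len (s i * w) = (len w).+1].
Proof.
have [N [N1 NM]] := inversion_cocycle; exists N; split=> // i w.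
have len_le u : len u <= (len (s i * u)).+1.
  by rewrite -{1}[u](genK i) -add1n (leq_trans (lenM _ _)) ?leq_add2r ?len_gen.
have lt u : N u (s i) -> len u = (len (s i * u)).+1.
  have [e se ue] := reduced_word u; rewrite {1}ue => /(strong_exchange N1 NM).
  rewrite -ue se => -[e' luE uE]; apply/eqP; rewrite eqn_leq len_le luE ltnS uE.
  exact: len_word.
(* If [s i] is not an inversion of [w], it is one of [s i * w], and [lt] applies there. *)
case: ifPn => [/lt//|Nw]; rewrite (lt (s i * w)) ?genK // NM eqxx.
by rewrite conjgE mulKg (negPf Nw).
Qed.

End Exchange.

(** * Products of commuting generators in the weak order *)

Section WeakOrderTheory.
Variables (I : finType) (m : I -> I -> nat) (W : groupType) (s : I -> W).
Hypotheses (m_diag : forall i, m i i = 1%N) (hW : coxeter_system m s).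
Local Notation len := (coxeter_length s).
Let gen_inv := gen_inv m_diag hW.
Let gen_sq := gen_sq m_diag hW.
Let genK := genK m_diag hW.
Let lenM := lenM hW.
Let lenV := lenV m_diag hW.
Let len1 := len1 hW.
Let len_eq0 := len_eq0 hW.

(** The cocycle sees left inversions, so descents are handled on the left; [left_descentV] relates
    them to [descents] by taking inverses. *)
Definition left_descent i w := len (s i * w) < len w.

Lemma left_descentP i w :
  if left_descent i w then len w = (len (s i * w)).+1
  else len (s i * w) = (len w).+1.
Proof.
rewrite /left_descent; have [N [_ _ /(_ i w)]] := left_inversions m_diag hW.
by case: ifP => _ ->; rewrite ?ltnS ?leqnn // ltnNge leqnSn.
Qed.

Lemma left_descent1 i : left_descent i 1 = false.
Proof. by rewrite /left_descent len1. Qed.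

Lemma left_descentK i w : left_descent i (s i * w) = ~~ left_descent i w.
Proof.
have := left_descentP i w; rewrite {2}/left_descent genK.
by case: ifP => _ ->; rewrite ?ltnS ?leqnn // ltnNge leqnSn.
Qed.

Lemma left_descent_exists w : w != 1 -> exists i, left_descent i w.
Proof.
have [[|i e] se we] := reduced_word hW w; first by rewrite we big_nil eqxx.
move=> _; exists i; rewrite /left_descent -se [w in _ * w]we big_cons genK /= ltnS.
exact: (len_word hW).
Qed.

Lemma left_descentV i w : left_descent i w^-1 = (i \in descents s w).
Proof.
by rewrite inE /left_descent -[len (w * _)]lenV invgM gen_inv [len w^-1]lenV.
Qed.

Lemma inversion_descent : exists N : W -> W -> bool,
 [/\ forall x, N 1 x = false,
     forall i w x, N (s i * w) x = (x == s i) (+) N w (x ^ s i)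
   & forall i w, left_descent i w = N w (s i)].
Proof.
have [N [N1 NM NP]] := left_inversions m_diag hW; exists N; split=> // i w.
rewrite /left_descent; have := NP i w.
by case: (N w (s i)) => ->; rewrite ?ltnS ?leqnn // ltnNge leqnSn.
Qed.

Lemma left_descent_commute i j w :
  commute (s i) (s j) -> s i != s j -> left_descent i (s j * w) = left_descent i w.
Proof.
have [N [_ NM NP]] := inversion_descent => cij /negPf nij.
by rewrite !NP NM nij conjgE cij mulKg.
Qed.

(** The only possible left inversions of [s i * s k] are [s i] and its conjugate [s i * s k * s i],
    so [s j] is the latter. *)
Lemma left_descent_rank2 i j k :
  left_descent j (s i * s k) -> s i != s j -> s j * s i = s i * s k.
Proof.
have [N [N1 NM NP]] := inversion_descent.
rewrite NP -[s k]mulg1 !NM N1 addbF mulg1 => + /negPf nij.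
by rewrite eq_sym nij => /eqP <-; rewrite -conjgC.
Qed.

Definition commuting (A : {set I}) := {in A &, forall i j, commute (s i) (s j)}.

Lemma commutingS (A B : {set I}) : A \subset B -> commuting B -> commuting A.
Proof. by move=> /subsetP AB cB i j /AB iB /AB; apply: cB. Qed.

(** The factors come in the enumeration order of [I]; this order is immaterial once [A] is
    commuting. *)
Definition gen_prod (A : {set I}) : W := \prod_(i in A) s i.

Lemma gen_prod0 : gen_prod set0 = 1.
Proof. by rewrite /gen_prod big_set0. Qed.

Lemma gen_prodU (A B : {set I}) : commuting (A :|: B) -> [disjoint A & B] ->
  gen_prod (A :|: B) = gen_prod A * gen_prod B.
Proof.
move=> cAB dAB; rewrite /gen_prod [in RHS]big_mkcond [X in _ * X]big_mkcond.
rewrite -prodgM_commute => [|i j _ _]; last first.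
  case: ifPn => iA; last exact/commute_sym/commute1.
  case: ifPn => jB; last exact/commute1.
  by apply: cAB; rewrite inE ?iA ?jB ?orbT.
rewrite big_mkcond; apply: eq_bigr => i _; rewrite inE.
have := disjointFr dAB (x := i); case: (i \in A) => [/(_ isT)->|_] /=.
  by rewrite mulg1.
by rewrite mul1g.
Qed.

Lemma gen_prodD1 (A : {set I}) i : commuting A -> i \in A ->
  gen_prod A = s i * gen_prod (A :\ i).
Proof.
move=> cA iA; rewrite -{1}(setD1K iA) gen_prodU ?setD1K ?disjoints1 ?in_setD1 ?eqxx //.
by rewrite /gen_prod big_set1.
Qed.

Lemma gen_prodD (A B : {set I}) : commuting A -> B \subset A ->
  (gen_prod B)^-1 * gen_prod A = gen_prod (A :\: B).
Proof.
move=> cA BA; have AE : B :|: (A :\: B) = A.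
  by apply/setP => i; rewrite !inE; case: (boolP (i \in B)) => // /(subsetP BA)->.
rewrite -{1}AE gen_prodU ?mulKg ?AE // -setI_eq0.
by apply/eqP/setP => i; rewrite !inE; case: (i \in B).
Qed.

Lemma gen_prodV (A : {set I}) : commuting A -> (gen_prod A)^-1 = gen_prod A.
Proof.
move=> cA; apply/mulg1_eq; rewrite /gen_prod -prodgM_commute; last exact: cA.
by rewrite big1 // => i _; rewrite gen_sq.
Qed.

(** Left multiplication by a different commuting generator preserves the descent status of [i], and
    multiplication by [s i] negates it. *)
Lemma left_descent_gen_prod_mul (A : {set I}) i u : commuting (i |: A) -> injective s ->
  left_descent i (gen_prod A * u) = (i \in A) (+) left_descent i u.
Proof.
move=> ciA injs.
have notinE (B : {set I}) : B \subset A -> i \notin B ->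
    left_descent i (gen_prod B * u) = left_descent i u.
  move=> /subsetP BA iB; rewrite /gen_prod; elim: index_enum => [|j r IHr].
    by rewrite big_nil mul1g.
  rewrite big_cons; case: ifP => // jB; rewrite -mulgA left_descent_commute //.
    by apply: ciA; rewrite !inE ?eqxx // BA ?orbT.
  by rewrite (inj_eq injs); apply: contraNneq iB => ->.
have [iA|/notinE->//] := boolP (i \in A).
have cA : commuting A by apply: commutingS ciA; apply: subsetUr.
by rewrite (gen_prodD1 cA iA) -mulgA left_descentK notinE ?subsetDl ?setD11.
Qed.

(** Factors are peeled off one at a time: each is an ascent of what follows it, so it adds one to
    the length. *)
Lemma gen_prod_mul (A : {set I}) u : commuting A -> injective s ->
    {in A, forall i, left_descent i u = false} ->
  len (gen_prod A * u) = #|A| + len u.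
Proof.
move=> + injs; have [n] := ubnP #|A|; elim: n A => // n IHn A nA cA dA.
have [->|[i iA]] := set_0Vmem A; first by rewrite gen_prod0 mul1g cards0.
have cAi : commuting (A :\ i) by apply: commutingS cA; apply: subsetDl.
rewrite (gen_prodD1 cA iA) -mulgA (cardsD1 i) iA.
have := left_descentP i (gen_prod (A :\ i) * u).
rewrite left_descent_gen_prod_mul ?setD1K // setD11 dA //= => ->.
rewrite IHn //; first by rewrite (cardsD1 i) iA in nA.
by move=> j /setD1P[_ /dA].
Qed.

(** This is [gen_prod_mul] for [(gen_prod A)^-1 * u]: as [gen_prod A] is an involution, multiplying
    by it turns the descents in [A] into ascents. *)
Lemma gen_prod_div (A : {set I}) u : commuting A -> injective s ->
    {in A, forall i, left_descent i u} ->
  len u = #|A| + len ((gen_prod A)^-1 * u).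
Proof.
move=> cA injs dA; rewrite -gen_prod_mul ?mulVKg // => i iA.
by rewrite gen_prodV // left_descent_gen_prod_mul ?iA ?dA // (setUidPr _) ?sub1set.
Qed.

Lemma len_gen_prod (A : {set I}) : commuting A -> injective s ->
  len (gen_prod A) = #|A|.
Proof.
move=> cA injs; rewrite -[gen_prod A]mulg1 gen_prod_mul ?len1 ?addn0 // => i _.
exact: left_descent1.
Qed.

Lemma len_mul_gen_prod (A : {set I}) v : commuting A -> injective s ->
  A \subset ~: descents s v -> len (v * gen_prod A) = len v + #|A|.
Proof.
move=> cA injs /subsetP Av.
rewrite -lenV invgM gen_prodV // gen_prod_mul ?lenV 1?addnC // => i /Av.
by rewrite left_descentV inE => /negPf.
Qed.

(** Since [i] may fail to commute with elements of [A], the argument goes through the cocycle: the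
    inversions of a product of commuting generators are among its factors. *)
Lemma left_descent_gen_prod (A : {set I}) i : commuting A -> injective s ->
  left_descent i (gen_prod A) = (i \in A).
Proof.
move=> cA injs; have [N [N1 NM NP]] := inversion_descent; apply/idP/idP; last first.
  move=> iA; have cAi : commuting (A :\ i) by apply: commutingS cA; apply: subsetDl.
  rewrite /left_descent (gen_prodD1 cA iA) genK -gen_prodD1 // !len_gen_prod //.
  by rewrite [#|A|](cardsD1 i) iA.
rewrite NP /gen_prod.
suff H r x : N (\prod_(j <- r | j \in A) s j) x -> exists2 j, j \in A & x = s j.
  by case/H => j jA /injs ->.
elim: r x => [|j r IHr] x; rewrite (big_nil, big_cons) ?N1 //.
case: ifP => [jA|_ /IHr //]; rewrite NM; have [-> _|_ /IHr[k kA]] := eqVneq x (s j).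
  by exists j.
move/(canRL (conjgK _)); rewrite conjgE invgK gen_inv cA // mulgA.
by rewrite gen_sq mul1g => ->; exists k.
Qed.

Local Notation wle := (weak_le s).

Lemma weak_leP u w : wle u w <-> len u + len (u^-1 * w) <= len w.
Proof.
split=> [<-//|le]; apply/eqP; rewrite eqn_leq le andbT.
by rewrite -{1}[w](mulVKg u) lenM.
Qed.

Lemma weak_lexx w : wle w w.
Proof. by rewrite /weak_le mulVg len1 addn0. Qed.

Lemma weak_le_anti u w : wle u w -> wle w u -> u = w.
Proof.
rewrite /weak_le => -> /eqP; rewrite -addnA -{1}[len u]addn0 eqn_add2l eq_sym addn_eq0.
by rewrite len_eq0 => /andP[/eqP/mulg1_eq]; rewrite invgK.
Qed.

Lemma weak_le_trans v u w : wle u v -> wle v w -> wle u w.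
Proof.
move=> uv vw; apply/weak_leP; rewrite vw uv -addnA leq_add2l.
by rewrite -[w in u^-1 * w](mulVKg v) mulgA lenM.
Qed.

(** This moves questions about an interval starting at [v] to one starting at 1. *)
Lemma weak_le_mul v x y : wle v (v * x) -> wle v (v * y) ->
  wle (v * x) (v * y) <-> wle x y.
Proof.
rewrite /weak_le !mulKg => -> ->; rewrite invgM -mulgA mulKg -addnA.
by split=> [/addnI|->].
Qed.

(** A left descent [i] of [y] is also one of [gen_prod A], hence lies in [A]; cancelling [s i] in
    both keeps the quotient and leaves a smaller set. *)
Lemma weak_le_gen_prod (A : {set I}) y : commuting A -> injective s ->
  wle y (gen_prod A) -> exists2 B : {set I}, B \subset A & y = gen_prod B.
Proof.
move=> + injs; have [n] := ubnP #|A|; elim: n A y => // n IHn A y nA cA yA.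
have [->|y1] := eqVneq y 1; first by exists set0; rewrite ?sub0set ?gen_prod0.
have [i di] := left_descent_exists y1.
have lenyi : len y = (len (s i * y)).+1 by have := left_descentP i y; rewrite di.
have yE : (s i * y)^-1 * (s i * gen_prod A) = y^-1 * gen_prod A.
  by rewrite invgM gen_inv -mulgA genK.
have iA : i \in A.
  rewrite -(left_descent_gen_prod _ cA injs) /left_descent yA.
  rewrite -[X in len X < _](mulVKg (s i * y)) yE lenyi addSn ltnS.
  exact: lenM.
have cAi : commuting (A :\ i) by apply: commutingS cA; apply: subsetDl.
have siA : s i * gen_prod A = gen_prod (A :\ i) by rewrite (gen_prodD1 cA iA) genK.
have [|//||B BA syB] := IHn (A :\ i) (s i * y).
- by rewrite (cardsD1 i) iA in nA.
- rewrite /weak_le -siA yE; apply/eqP; rewrite -eqSS -addSn -lenyi -yA siA.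
  by rewrite !len_gen_prod // [#|A|](cardsD1 i) iA.
have BiA : i |: B \subset A by rewrite subUset sub1set iA (subset_trans BA) ?subsetDl.
exists (i |: B) => //.
have iB : i \notin B by apply/negP => /(subsetP BA); rewrite setD11.
rewrite (@gen_prodD1 _ i) ?setU1K ?setU11 //; last exact: commutingS cA.
by rewrite -syB genK.
Qed.

Lemma gen_prod_inj (A B : {set I}) : commuting A -> commuting B -> injective s ->
  gen_prod A = gen_prod B -> A = B.
Proof.
move=> cA cB injs eAB; apply/setP => i.
by rewrite -(left_descent_gen_prod i cA) // eAB left_descent_gen_prod.
Qed.

Lemma gen_prod_le (A B : {set I}) : commuting A -> commuting B -> injective s ->
  wle (gen_prod A) (gen_prod B) <-> A \subset B.
Proof.
move=> cA cB injs; split=> [/(weak_le_gen_prod cB injs)[C CB eAC]|AB].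
  by rewrite (gen_prod_inj cA (commutingS CB cB) injs eAC).
rewrite /weak_le gen_prodD // !len_gen_prod //; last first.
  by apply: commutingS cB; apply: subsetDl.
by rewrite -(cardsID A B) (setIidPr AB).
Qed.

Section IntervalAbove.
Variables (v : W) (J : {set I}).
Hypotheses (cJ : commuting J) (injs : injective s).
Hypothesis (Jv : J \subset ~: descents s v).

Lemma weak_le_mul_gen_prod (A : {set I}) :
  A \subset J -> wle v (v * gen_prod A).
Proof.
move=> AJ; have cA := commutingS AJ cJ.
by rewrite /weak_le mulKg len_gen_prod // len_mul_gen_prod // (subset_trans AJ).
Qed.

Lemma mul_gen_prod_le (A B : {set I}) : A \subset J -> B \subset J ->
  wle (v * gen_prod A) (v * gen_prod B) <-> A \subset B.
Proof.
move=> AJ BJ; have cA := commutingS AJ cJ; have cB := commutingS BJ cJ.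
by rewrite -(gen_prod_le cA cB injs) weak_le_mul //; apply: weak_le_mul_gen_prod.
Qed.

Lemma interval_mul_gen_prod :
  weak_interval s v (v * gen_prod J) =
  mkset (fun x => exists2 A : {set I}, A \subset J & x = v * gen_prod A).
Proof.
apply/seteqP; split=> [x [vx xJ]|_ [A AJ ->]]; last first.
  by split; [exact: weak_le_mul_gen_prod | exact/mul_gen_prod_le].
rewrite -(mulVKg v x) in vx xJ *.
have [A AJ ->] := weak_le_gen_prod cJ injs
  ((weak_le_mul vx (weak_le_mul_gen_prod (subxx _))).1 xJ).
by exists A.
Qed.

Lemma is_boolean_mul_gen_prod :
  is_boolean s (weak_interval s v (v * gen_prod J)).
Proof.
have sJ (A : {set {i | i \in J}}) : [set val x | x in A] \subset J.
  by apply/subsetP => _ /imsetP[x _ ->]; apply: valP.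
pose T : finType := {i | i \in J}.
exists T, (fun A : {set T} => v * gen_prod [set val x | x in A]).
have le (A B : {set T}) : A \subset B <->
    wle (v * gen_prod [set val x | x in A]) (v * gen_prod [set val x | x in B]).
  rewrite mul_gen_prod_le //; split=> [|/subsetP AB]; first exact: imsetS.
  apply/subsetP => x xA.
  by have /imsetP[y yB /val_inj->] := AB _ (imset_f val xA).
split=> //; rewrite interval_mul_gen_prod; split=> [A _|A B _ _ eAB|x [A AJ ->]].
- by exists [set val x | x in A].
(* An order embedding is injective, by reflexivity of the weak order and antisymmetry of
   inclusion. *)
- by apply/eqP; rewrite eqEsubset; apply/andP; split; apply/le; rewrite eAB;
    apply: weak_lexx.
- exists (val @^-1: A) => //; congr (_ * gen_prod _).
  apply/setP => i; apply/imsetP/idP => [[y + ->]|iA]; first by rewrite inE.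
  by exists (Sub i (subsetP AJ i iA)); rewrite ?inE.
Qed.

End IntervalAbove.

(** The generator is the first letter of a reduced word of [x^-1 * y]. *)
Lemma weak_le_cover x y : wle x y -> x != y ->
  exists i, [/\ wle x (x * s i), wle (x * s i) y & len (x * s i) = (len x).+1].
Proof.
move=> xy nxy.
have [|i di] := @left_descent_exists (x^-1 * y); first by rewrite mulg_eq1 eqg_inv.
have := left_descentP i (x^-1 * y); rewrite di => lenz.
have yE : (x * s i)^-1 * y = s i * (x^-1 * y) by rewrite invgM gen_inv mulgA.
have lenxi : len (x * s i) = (len x).+1.
  apply/eqP; rewrite eqn_leq -addn1 (leq_trans (lenM _ _)) ?leq_add2l ?(len_gen hW) //.
  rewrite -(leq_add2r (len (s i * (x^-1 * y)))) -addnA add1n -lenz -xy.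
  by rewrite -yE -{1}[y](mulVKg (x * s i)) lenM.
exists i; split=> //; last by rewrite /weak_le yE lenxi addSnnS -lenz -xy.
by apply/weak_leP; rewrite mulKg lenxi -addn1 leq_add2l (len_gen hW).
Qed.

(** The isomorphism [f] turns cardinality into length above [v], so singletons go to atoms
    [v * s i]. These generators commute pairwise, and their product has the length of [v^-1 * w],
    which forces equality. *)
Lemma boolean_interval_gen_prod v w : injective s -> wle v w ->
    is_boolean s (weak_interval s v w) ->
  exists J : {set I}, [/\ J \subset ~: descents s v, commuting J & w = v * gen_prod J].
Proof.
move=> injs vw [T [f [[fX finj fsurj] le]]].
have {}finj : injective f by move=> A B; apply: finj; rewrite in_setE.
have inX A : wle v (f A) /\ wle (f A) w by apply: fX.
have onX x : wle v x -> wle x w -> exists A, f A = x.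
  by move=> vx xw; have [A _ <-] := fsurj x (conj vx xw); exists A.
have f0 : f set0 = v.
  have [A fA] := onX v (weak_lexx v) vw; apply: weak_le_anti; last by case: (inX set0).
  by rewrite -fA; apply/le; apply: sub0set.
have fT : f setT = w.
  have [A fA] := onX w vw (weak_lexx w); apply: weak_le_anti; first by case: (inX setT).
  by rewrite -fA; apply/le; apply: subsetT.
(* The element covering [f A] below [f (t |: A)] comes from a set between [A] and [t |: A], and its
   length excludes [A]. *)
have step (A : {set T}) t : t \notin A ->
    exists2 i, f (t |: A) = f A * s i & len (f (t |: A)) = (len (f A)).+1.
  move=> tA.
  have [||i [Ai iAt leni]] := @weak_le_cover (f A) (f (t |: A)).
  - by apply/le; apply: subsetUr.
  - by rewrite (inj_eq finj); apply: contraNneq tA => ->; rewrite setU11.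
  have [vA _] := inX A; have [_ Atw] := inX (t |: A).
  have [B fB] := onX _ (weak_le_trans vA Ai) (weak_le_trans iAt Atw).
  move: Ai iAt; rewrite -fB => /le AB /le BtA.
  suff BE : B = t |: A by exists i; rewrite -BE // fB.
  apply/eqP; rewrite eqEsubset BtA subUset AB andbT sub1set.
  apply: contraTT isT => tB; have BA : B = A.
    apply/eqP; rewrite eqEsubset AB andbT; apply/subsetP => x xB.
    by have /(subsetP BtA) := xB; rewrite !inE => /orP[/eqP xt|//]; rewrite -xt xB in tB.
  by move: leni; rewrite -fB BA => /eqP; rewrite ltn_eqF.
have lenf A : len (f A) = len v + #|A|.
  have [n] := ubnP #|A|; elim: n A => // n IHn A nA.
  have [->|[t tA]] := set_0Vmem A; first by rewrite f0 cards0 addn0.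
  have [|_ _] := step (A :\ t) t; first by rewrite setD11.
  rewrite setD1K // => ->; rewrite IHn ?(cardsD1 t A) ?tA ?addnS //.
  by rewrite (cardsD1 t) tA in nA.
have /fin_all_exists[g gE] (t : T) : exists i, f [set t] = v * s i.
  by have [|i] := step set0 t; rewrite ?inE // f0 setU0; exists i.
have ginj : injective g.
  by move=> t t' gt; apply/set1_inj/finj; rewrite !gE gt.
have pairE t t' : t != t' -> exists k, f [set t; t'] = v * (s (g t) * s k).
  move=> tt'; have [|k + _] := step [set t] t'; first by rewrite inE eq_sym.
  by rewrite gE -mulgA setUC => ->; exists k.
(* The join of two atoms lies two levels above [v], so [s (g t) * s k] has length at least 2;
   multiplied on the left by [s (g t')] it becomes [s l], of length at most 1. *)
have rank2 t t' k l : t != t' -> s (g t) * s k = s (g t') * s l ->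
    f [set t; t'] = v * (s (g t) * s k) -> s (g t') * s (g t) = s (g t) * s k.
  move=> tt' eq2 fE; apply: left_descent_rank2; last first.
    by rewrite !(inj_eq injs, inj_eq ginj).
  rewrite /left_descent [X in s _ * X]eq2 genK (leq_ltn_trans (len_gen hW l)) //.
  by have := lenM v (s (g t) * s k); rewrite -fE lenf cards2 tt' leq_add2l.
pose J := [set g t | t in setT].
have cJ : commuting J.
  move=> _ _ /imsetP[t _ ->] /imsetP[t' _ ->].
  have [->|tt'] := eqVneq t t'; first exact: commute_refl.
  have t't : t' != t by rewrite eq_sym.
  have [k ftk] := pairE _ _ tt'; have [l ftl] := pairE _ _ t't.
  have eq2 : s (g t) * s k = s (g t') * s l.
    by apply: (mulgI v); rewrite -ftk -ftl setUC.
  (* Both orders of the product of [s (g t)] and [s (g t')] lead from [v] to the same join. *)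
  by rewrite /commute (rank2 _ _ _ _ tt' eq2 ftk) (rank2 _ _ _ _ t't (esym eq2) ftl).
have cardJ : #|J| = #|T| by rewrite card_imset ?cardsT.
have lenw : len w = len v + #|T| by rewrite -fT lenf cardsT.
have JP i : i \in J -> len (v * s i) = (len v).+1 /\ wle (v * s i) w.
  by case/imsetP=> t _ ->; rewrite -gE lenf cards1 addn1; have [] := inX [set t].
exists J; split=> //.
  by apply/subsetP => i /JP[leni _]; rewrite !inE leni ltnNge leqnSn.
have lenu : len (v^-1 * w) = #|T| by apply: (@addnI (len v)); rewrite -vw lenw.
rewrite -{1}(mulVKg v w); congr (_ * _).
(* [gen_prod J] splits off from [v^-1 * w] and accounts for its whole length, so the remaining
   factor has length 0. *)
have := @gen_prod_div J (v^-1 * w) cJ injs.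
rewrite lenu cardJ => /(_ _)/eqP; rewrite -{1}[#|T|]addn0 eqn_add2l eq_sym len_eq0.
rewrite mulg_eq1 eqg_inv => H; apply/esym/eqP/H => i /JP[leni].
rewrite /weak_le leni invgM gen_inv -mulgA vw => /eqP.
by rewrite addSnnS eqn_add2l => /eqP lu; rewrite /left_descent lu.
Qed.

End WeakOrderTheory.

(** * Boolean intervals as independent sets of ascents *)

Definition independent (I : finType) (e : rel I) (J : {set I}) :=
  [forall i in J, forall j in J, ~~ e i j].

Lemma independentP (I : finType) (e : rel I) (J : {set I}) :
  reflect {in J &, forall i j, ~~ e i j} (independent e J).
Proof.
apply: (iffP forall_inP) => H i; first by move=> j /H/forall_inP; apply.
by move=> iJ; apply/forall_inP => j; apply: H.
Qed.

Definition independent_subsets (I : finType) (e : rel I) (A : {set I}) :=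
  [set J : {set I} | (J \subset A) && independent e J].

(** Independent means pairwise commuting here, so sending [J] to the interval from [v] to
    [v * gen_prod s J] is a bijection from independent sets of ascents to Boolean intervals. *)
Lemma card_boolean_intervals (I : finType) (m : I -> I -> nat) (W : groupType)
    (s : I -> W) (v : W) :
  (forall i, m i i = 1%N) -> coxeter_system m s -> injective s ->
  (forall i j, commute (s i) (s j) <-> ~~ coxeter_edge m i j) ->
  (boolean_intervals_from s v #=
    `I_#|independent_subsets (coxeter_edge m) (~: descents s v)|)%card.
Proof.
move=> m_diag hW injs edgeP; set IS := independent_subsets _ _.
have commP J : commuting s J <-> independent (coxeter_edge m) J.
  split=> [cJ|/independentP iJ i j iJ' jJ]; last by apply/edgeP/iJ.
  by apply/independentP => i j iJ jJ; apply/edgeP/cJ.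
pose g J := weak_interval s v (v * gen_prod s J).
have -> : boolean_intervals_from s v = (g @` [set` IS])%classic.
  apply/seteqP; split=> [_ [w [vw -> bw]]|_ [J + <-]].
    have [J [Jv /commP cJ ->]] := boolean_interval_gen_prod m_diag hW injs vw bw.
    by exists J; rewrite //= inE Jv.
  rewrite /= inE => /andP[Jv /commP cJ]; exists (v * gen_prod s J); split=> //.
    exact: weak_le_mul_gen_prod cJ injs Jv _ (subxx _).
  exact: is_boolean_mul_gen_prod cJ injs Jv.
(* The interval determines its top by antisymmetry, and the top determines [J]. *)
have ginj : {in [set` IS]%classic &, injective g}.
  move=> J K; rewrite !in_setE /= !inE => /andP[Jv /commP cJ] /andP[Kv /commP cK] gJK.
  apply: (gen_prod_inj m_diag hW cJ cK injs); apply: (mulgI v).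
  have vJ := weak_le_mul_gen_prod m_diag hW cJ injs Jv (subxx _).
  have vK := weak_le_mul_gen_prod m_diag hW cK injs Kv (subxx _).
  have [_ KJ] : g J (v * gen_prod s K) by rewrite gJK; split=> //; apply: weak_lexx hW _.
  have [_ JK] : g K (v * gen_prod s J) by rewrite -gJK; split=> //; apply: weak_lexx hW _.
  exact: (weak_le_anti hW JK KJ).
rewrite (card_eql (inj_card_eq ginj)).
have -> : [set` IS]%classic = (enum_val @` [set: 'I_#|IS|])%classic.
  apply/seteqP; split=> [J IJ|_ [k _ <-]]; last exact: enum_valP.
  by exists (enum_rank_in IJ J); rewrite ?enum_rankK_in.
rewrite (card_eql (inj_card_eq _)); first by rewrite card_eq_sym card_II.
by move=> k l _ _; apply: enum_val_inj.
Qed.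

(** * Powers of products of two involutions *)

Lemma involution_commute_expg2 (G : groupType) (a b : G) :
  a * a = 1 -> b * b = 1 -> commute a b -> (a * b) ^+ 2 = 1.
Proof. by move=> aa bb cab; rewrite expgMn // !expg2 aa bb mulg1. Qed.

(** With [a] and [b] the two transpositions, [a * b * a] and [b * a * b] are both [tperm x z], and
    [(a * b) ^+ 3] is their product. *)
Lemma tperm_braid (T : finType) (x y z : T) : x != y -> y != z -> x != z ->
  (tperm x y * tperm y z) ^+ 3 = 1.
Proof.
move=> xy yz xz; set a := tperm x y; set b := tperm y z.
have aba : a * b * a = tperm x z.
  by rewrite -mulgA -{1}[a]tpermV -conjgE tpermJ tpermR tpermD.
have bab : b * a * b = tperm x z.
  by rewrite -mulgA -{1}[b]tpermV -conjgE tpermJ tpermL tpermD // eq_sym.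
by rewrite !expgS expg0 mulg1 !mulgA aba -!mulgA (mulgA b) bab tperm2.
Qed.

(** The square of [a * b] is [b ^ a * b], a product of two commuting involutions. *)
Lemma involution_conj_expg4 (G : groupType) (a b : G) :
  a * a = 1 -> b * b = 1 -> commute (b ^ a) b -> (a * b) ^+ 4 = 1.
Proof.
move=> aa bb cab; rewrite (expgnA _ 2 2) (expg2 (a * b)).
have -> : a * b * (a * b) = b ^ a * b by rewrite conjgE (mulg1_eq aa) !mulgA.
by rewrite involution_commute_expg2 // -conjMg bb conj1g.
Qed.

(** * Signed permutations separate the generators of type C *)

Section SignedPermutations.
Variable n : nat.
Hypothesis n_ge2 : 2 <= n.

Definition lift_fun (p : {perm 'I_n}) (x : 'I_n * bool) := (p x.1, x.2).

Lemma lift_fun_inj p : injective (lift_fun p).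
Proof. by move=> [x b] [y c] [/perm_inj -> ->]. Qed.

Definition sign_lift p : {perm 'I_n * bool} := perm (@lift_fun_inj p).

Lemma sign_liftE p x b : sign_lift p (x, b) = (p x, b).
Proof. by rewrite permE. Qed.

Lemma sign_liftM p q : sign_lift (p * q) = sign_lift p * sign_lift q.
Proof. by apply/permP => -[x b]; rewrite permM !sign_liftE permM. Qed.

Lemma sign_lift1 : sign_lift 1 = 1.
Proof. by apply/permP => -[x b]; rewrite sign_liftE !perm1. Qed.

Lemma sign_liftX p k : sign_lift (p ^+ k) = sign_lift p ^+ k.
Proof.
elim: k => [|k IHk]; first by rewrite !expg0 sign_lift1.
by rewrite !expgS sign_liftM IHk.
Qed.

(** A pair is a coordinate with a sign, which recodes the permutations of 2n letters. [ordS] is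
    cyclic and would wrap at the last index, where the generator changes a sign instead. *)
Definition signed_gen (i : 'I_n) : {perm 'I_n * bool} :=
  if i.+1 < n then sign_lift (tperm i (ordS i)) else tperm (i, false) (i, true).

Lemma val_ordS (i : 'I_n) : i.+1 < n -> ordS i = i.+1 :> nat.
Proof. exact: modn_small. Qed.

Lemma signed_gen_sq i : signed_gen i * signed_gen i = 1.
Proof. by rewrite /signed_gen; case: ifP; rewrite -?sign_liftM tperm2 ?sign_lift1. Qed.

Lemma signed_gen_succ (i : 'I_n) b : i.+1 < n -> signed_gen i (i, b) = (ordS i, b).
Proof. by move=> iS; rewrite /signed_gen iS sign_liftE tpermL. Qed.

Lemma signed_gen_fix (i j : 'I_n) b : i < j -> signed_gen j (i, b) = (i, b).
Proof.
move=> ij; have nij : j != i by rewrite neq_ltn ij orbT.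
rewrite /signed_gen; case: ifP => jS; last first.
  by rewrite tpermD // xpair_eqE (negPf nij).
by rewrite sign_liftE tpermD // -val_eqE /= modn_small //; lia.
Qed.

Lemma signed_gen_move (i : 'I_n) : signed_gen i (i, false) != (i, false).
Proof.
have [iS|iS] := boolP (i.+1 < n).
  by rewrite signed_gen_succ // xpair_eqE andbT -val_eqE /= modn_small //; lia.
by rewrite /signed_gen (negPf iS) tpermL xpair_eqE andbF.
Qed.

Lemma signed_gen_inj : injective signed_gen.
Proof.
have neq (i j : 'I_n) : i < j -> signed_gen i != signed_gen j.
  move=> ij; apply: contraNneq (signed_gen_move i) => ->.
  by rewrite signed_gen_fix.
move=> i j; case: (ltngtP i j) => [/neq/eqP//|/neq/eqP + /esym//|/val_inj//].
Qed.

Lemma signed_gen_noncommute (i j : 'I_n) : i.+1 = j ->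
  ~ commute (signed_gen i) (signed_gen j).
Proof.
move=> ij; have iS : i.+1 < n by rewrite ij.
have jE : j = ordS i by apply/val_inj; rewrite /= modn_small.
(* At [(i, false)] one product gives [(j, false)] and the other its image under [signed_gen j],
   which moves it. *)
move/permP/(_ (i, false)); rewrite !permM (@signed_gen_fix i j) -?ij //.
rewrite signed_gen_succ //.
by rewrite -jE; apply/eqP/signed_gen_move.
Qed.

Lemma signed_gen_relations : coxeter_relations (@coxeter_matrix_C n) signed_gen.
Proof.
(* Swapping the two factors conjugates the product, which reduces the relations to [i < j]. *)
have wlog_lt i j k : (signed_gen i * signed_gen j) ^+ k = 1 ->
    (signed_gen j * signed_gen i) ^+ k = 1.
  move=> ijk; have -> : signed_gen j * signed_gen i =
      (signed_gen i * signed_gen j) ^ signed_gen i.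
    by rewrite conjgE (mulg1_eq (signed_gen_sq i)) !mulgA signed_gen_sq mul1g.
  by rewrite -conjXg ijk conj1g.
have mC i j : coxeter_matrix_C i j = coxeter_matrix_C j i :> nat.
  by rewrite /coxeter_matrix_C eq_sym orbC maxnC.
suff lt (i j : 'I_n) : i < j -> (signed_gen i * signed_gen j) ^+ coxeter_matrix_C i j = 1.
  move=> i j; case: (ltngtP i j) => [/lt//|/lt|/val_inj->].
    by move/wlog_lt; rewrite mC.
  by rewrite /coxeter_matrix_C eqxx expg1 signed_gen_sq.
move=> ij; have iS : i.+1 < n by apply: leq_ltn_trans (ltn_ord j).
have nij : i != j by rewrite neq_ltn ij.
rewrite /coxeter_matrix_C (negPf nij).
have -> : (j.+1 == i) = false by lia.
have -> : maxn i j = j by lia.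
rewrite orbF; have [ijS|ijS] := eqVneq i.+1 (j : nat).
  have jE : j = ordS i by apply/val_inj; rewrite /= modn_small.
  have [jl|jl] := eqVneq (j : nat) n.-1.
    (* Conjugating the sign change of [j] by the swap gives the sign change of [i], and these two
       have disjoint supports. *)
    apply: involution_conj_expg4; rewrite ?signed_gen_sq // {1 3}/signed_gen.
    have -> : (j.+1 < n) = false by lia.
    have ji b : signed_gen i (j, b) = (i, b).
      by rewrite /signed_gen iS sign_liftE jE tpermR.
    rewrite tpermJ !ji /commute conjgC tpermJ !tpermD // xpair_eqE eq_sym (negPf nij) //.
  have jS : j.+1 < n by have := ltn_ord j; lia.
  have jSS : j.+1 = ordS j by rewrite val_ordS.
  rewrite /signed_gen iS jS -sign_liftM -sign_liftX -jE tperm_braid ?sign_lift1 //.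
    by apply/eqP => /(congr1 (@nat_of_ord n)); lia.
  by apply/eqP => /(congr1 (@nat_of_ord n)); lia.
(* The remaining pairs have [i.+1 < j], so the two generators move disjoint sets of coordinates. *)
apply: involution_commute_expg2; rewrite ?signed_gen_sq //.
have iSS : ordS i = i.+1 :> nat by rewrite val_ordS.
have ti (k : 'I_n) : j <= k -> tperm i (ordS i) k = k.
  by move=> jk; rewrite tpermD //; apply/eqP => /(congr1 (@nat_of_ord n)); lia.
rewrite /signed_gen iS; case: ifP => jS; last first.
  by apply/commute_sym; rewrite /commute conjgC tpermJ !sign_liftE !ti.
rewrite /commute -!sign_liftM; congr sign_lift; apply/commute_sym.
by rewrite /commute conjgC tpermJ !ti // val_ordS.
Qed.

End SignedPermutations.

(** * Commutation in the Coxeter group of type C *)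

Lemma coxeter_matrix_C_diag n (i : 'I_n) : coxeter_matrix_C i i = 1%N.
Proof. by rewrite /coxeter_matrix_C eqxx. Qed.

Lemma coxeter_edge_C n (i j : 'I_n) :
  coxeter_edge (@coxeter_matrix_C n) i j = (i.+1 == j :> nat) || (j.+1 == i :> nat).
Proof.
rewrite /coxeter_edge /coxeter_matrix_C; case: eqVneq => [->|_] /=; first by lia.
by case: ifP; [case: ifP|].
Qed.

Section TypeC.
Variables (n : nat) (W : groupType) (s : 'I_n -> W).
Hypotheses (n_ge2 : 2 <= n) (hW : coxeter_system (@coxeter_matrix_C n) s).

Lemma signed_representation :
  exists phi : {multiplicative W -> {perm 'I_n * bool}},
    forall i, phi (s i) = signed_gen i.
Proof. by have [_ _] := hW; apply; apply: signed_gen_relations. Qed.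

Lemma gen_inj_C : injective s.
Proof.
have [phi phiE] := signed_representation.
by move=> i j sij; apply: (signed_gen_inj n_ge2); rewrite -!phiE sij.
Qed.

(** Adjacent generators fail to commute already in their images as signed permutations; for other
    distinct pairs the relation of exponent 2 says that they commute. *)
Lemma commute_gen_C i j :
  commute (s i) (s j) <-> ~~ coxeter_edge (@coxeter_matrix_C n) i j.
Proof.
have [phi phiE] := signed_representation.
have nc (k l : 'I_n) : k.+1 = l :> nat -> ~ commute (s k) (s l).
  move=> kl ckl; apply: (signed_gen_noncommute n_ge2 kl).
  by rewrite -!phiE; apply: gmulf_commute.
split=> [cij|].
  rewrite coxeter_edge_C; apply/norP; split; apply/eqP => /nc; [exact|].
  by apply; apply: commute_sym.
rewrite /coxeter_edge; case: eqVneq => [-> _|_ /=]; first exact: commute_refl.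
rewrite negbK => /eqP mij; have [/(_ i j) + _ _] := hW.
rewrite mij expg2 => /mulg1_eq.
rewrite invgM !(gen_inv (@coxeter_matrix_C_diag n) hW) => /esym; exact.
Qed.

End TypeC.

Local Close Scope group_scope.

(** * Independent subsets of a path *)

Section IndependentSubsets.
Variables (I : finType) (e : rel I).
Implicit Types A B J : {set I}.
Local Notation ind A := #|independent_subsets e A|.

Lemma independentS A B : A \subset B -> independent e B -> independent e A.
Proof.
by move=> /subsetP AB /independentP iB; apply/independentP => i j /AB iA /AB; apply: iB.
Qed.

Lemma card_independent_subsets0 : ind set0 = 1.
Proof.
rewrite -(cards1 (set0 : {set I})); congr #|pred_of_set _|; apply/setP => J.
rewrite !inE subset0; case: eqP => // ->; apply/independentP => i.
by rewrite inE.
Qed.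

(** Intersecting with [A] and with [B] splits an independent set into two that can be chosen
    freely. *)
Lemma card_independent_subsetsU A B : [disjoint A & B] ->
  {in A & B, forall i j, ~~ e i j && ~~ e j i} -> ind (A :|: B) = ind A * ind B.
Proof.
move=> dAB eAB; rewrite -cardsX.
pose g (p : {set I} * {set I}) := p.1 :|: p.2.
have capE C J K : J :|: K = C -> J \subset A -> K \subset B -> C :&: A = J /\ C :&: B = K.
  move=> <- JA KB; rewrite !setIUl (setIidPl JA) (setIidPl KB).
  have -> : K :&: A = set0.
    by apply/disjoint_setI0; rewrite disjoint_sym (disjointWr KB).
  have -> : J :&: B = set0 by apply/disjoint_setI0; rewrite (disjointWl JA).
  by rewrite setU0 set0U.
rewrite -(card_in_imset (f := g)) => [|[J K] [J' K']]; last first.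
  rewrite !inE /= /g /= => /andP[/andP[JA _] /andP[KB _]].
  move=> /andP[/andP[JA' _] /andP[KB' _]] E.
  have [<- <-] := capE _ _ _ E JA KB; have [JE KE] := capE _ _ _ erefl JA' KB'.
  by rewrite JE KE.
congr #|pred_of_set _|; apply/setP => C; rewrite inE; apply/idP/imsetP.
  case/andP=> CAB iC; exists (C :&: A, C :&: B); last first.
    by rewrite /g -setIUr (setIidPl CAB).
  by rewrite !inE /= !subsetIr !(independentS _ iC) ?subsetIl.
case=> -[J K]; rewrite !inE /= => /andP[/andP[JA iJ] /andP[KB iK]] ->.
rewrite setUSS //=; apply/independentP => i j; rewrite !inE.
move: iJ iK => /independentP iJ /independentP iK.
move=> /orP[iJ'|iK'] /orP[jJ|jK]; [exact: iJ | | | exact: iK].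
  by have /andP[] := eAB i j (subsetP JA _ iJ') (subsetP KB _ jK).
by have /andP[] := eAB j i (subsetP JA _ jJ) (subsetP KB _ iK').
Qed.

Lemma mem_bigcup_seq (r : seq {set I}) i :
  (i \in \bigcup_(A <- r) A) = has (fun A : {set I} => i \in A) r.
Proof.
by elim: r => [|A r IHr]; rewrite ?big_nil ?big_cons !inE //= IHr.
Qed.

Lemma card_independent_subsets_bigcup (r : seq {set I}) :
  {in r &, forall A B, A != B -> [disjoint A & B]} ->
  {in r &, forall A B, A != B -> {in A & B, forall i j, ~~ e i j}} -> uniq r ->
  ind (\bigcup_(A <- r) A) = \prod_(A <- r) ind A.
Proof.
elim: r => [|A r IHr] dr er; first by rewrite !big_nil card_independent_subsets0.
move=> /= /andP[Ar ur]; rewrite !big_cons card_independent_subsetsU.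
- rewrite IHr // => B C Br Cr; [apply: dr | apply: er]; exact: mem_behead.
- apply/pred0P => i /=; apply/negP => /andP[iA].
  rewrite mem_bigcup_seq => /hasP[B Br iB].
  have AB : A != B by apply: contraNneq Ar => ->.
  have /disjointFr/(_ iA) := dr A B (mem_head _ _) (mem_behead (s := A :: r) Br) AB.
  by rewrite iB.
- move=> i j iA; rewrite mem_bigcup_seq => /hasP[B Br jB].
  have AB : A != B by apply: contraNneq Ar => ->.
  have rA := mem_head A r; have rB := mem_behead (s := A :: r) Br.
  by rewrite (er A B rA rB AB _ _ iA jB) (er B A rB rA _ _ _ jB iA) // eq_sym.
Qed.

Hypotheses (e_irr : irreflexive e) (e_sym : symmetric e).

(** The terms count the independent sets without [i] and those with [i]; the latter are [i |: K]
    with [K] avoiding [i] and its neighbours. *)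
Lemma card_independent_subsetsD1 A i : i \in A ->
  ind A = ind (A :\ i) + ind (A :\ i :\: [set j | e i j]).
Proof.
have subE (K : {set I}) : (K \subset A :\ i :\: [set j | e i j]) =
    [&& K \subset A, i \notin K & [disjoint K & [set j | e i j]]].
  by rewrite subsetD subsetD1 andbA.
move=> iA; rewrite -(cardsID [set J : {set I} | i \notin J]); congr (_ + _).
  congr #|pred_of_set _|; apply/setP => J; rewrite !inE subsetD1.
  by rewrite -!andbA; congr (_ && _); rewrite andbC.
rewrite -[RHS](card_in_imset (f := fun J : {set I} => i |: J)) => [|J K]; last first.
  rewrite !inE !subE => /andP[/and3P[_ iJ _] _] /andP[/and3P[_ iK _] _] E.
  by rewrite -(setU1K iJ) E setU1K.
congr #|pred_of_set _|; apply/setP => J; rewrite !inE negbK; apply/idP/imsetP.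
  case/and3P=> iJ JA /independentP indJ; exists (J :\ i); last by rewrite setD1K.
  rewrite inE subE (subset_trans (subsetDl _ _) JA) setD11; apply/andP; split.
    apply/pred0P => j /=; rewrite !inE; apply/negP => /andP[/andP[_ jJ]].
    by apply/negP/indJ.
  by apply: independentS (subsetDl _ _) _; apply/independentP.
case=> K; rewrite inE subE => /andP[/and3P[KA iK dK] /independentP indK] ->.
have eiK k : k \in K -> ~~ e i k.
  by move=> kK; have := disjointFr dK kK; rewrite inE => ->.
rewrite setU11 subUset sub1set iA KA /=; apply/independentP => j k.
rewrite !inE => /orP[/eqP->|jK] /orP[/eqP->|kK]; rewrite ?e_irr ?eiK //.
- by rewrite e_sym eiK.
- exact: indK.
Qed.

End IndependentSubsets.

(** An edge within [A] joins vertices of the same component, so the choices in different components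
    do not interact. *)
Lemma card_independent_subsets_components (I : finType) (m : I -> I -> nat)
    (A : {set I}) :
  symmetric (coxeter_edge m) ->
  #|independent_subsets (coxeter_edge m) A| =
  \prod_(b in induced_components m A) #|independent_subsets (coxeter_edge m) b|.
Proof.
move=> m_sym; set R := connect (induced_edge m A).
have R_sym : connect_sym (induced_edge m A).
  by apply: sym_connect_sym => i j; rewrite /induced_edge m_sym andbCA.
have eqR : {in A & &, equivalence_rel R}.
  move=> i j k _ _ _; split=> [|Rij]; first exact: connect0.
  exact: (same_connect R_sym Rij).
have partA := equivalence_partitionP eqR; have /and3P[/eqP covA trivA _] := partA.
rewrite -[X in independent_subsets _ X]covA /cover -[X in _ = X]big_enum -big_enum /=.
apply: card_independent_subsets_bigcup; last exact: enum_uniq.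
  by move=> B C; rewrite !mem_enum; apply: (trivIsetP trivA).
move=> B C; rewrite !mem_enum => BP CP BC i j iB jC; apply: contra BC => eij.
have inA D k : D \in induced_components m A -> k \in D -> k \in A.
  by move=> DP kD; rewrite -covA; apply/bigcupP; exists D.
have [iA jA] := (inA B i BP iB, inA C j CP jC).
rewrite -(def_pblock trivA BP iB) -(def_pblock trivA CP jC) eq_pblock ?covA //.
rewrite pblock_equivalence_partition //.
by apply: connect1; rewrite /induced_edge iA jA.
Qed.

Section Path.
Variables (n : nat).
Local Notation e := (coxeter_edge (@coxeter_matrix_C n)).
Implicit Types A b : {set 'I_n}.

Lemma coxeter_edge_C_sym : symmetric e.
Proof. by move=> i j; rewrite !coxeter_edge_C orbC. Qed.

Lemma coxeter_edge_C_irr : irreflexive e.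
Proof. by move=> i; rewrite /coxeter_edge eqxx. Qed.

Definition convex b :=
  forall i j k : 'I_n, i \in b -> j \in b -> i <= k <= j -> k \in b.

(** A walk in the path graph moves by one at each step, so it visits every vertex between its
    ends. *)
Lemma connect_induced_between A (i j k : 'I_n) :
  connect (induced_edge (@coxeter_matrix_C n) A) i j -> i <= k <= j ->
  connect (induced_edge (@coxeter_matrix_C n) A) i k.
Proof.
case/connectP => p; elim: p i => [|x p IHp] i /=.
  move=> _ -> ik; have -> : k = i by apply/val_inj; rewrite /=; lia.
  exact: connect0.
case/andP=> eix px jE /andP[ik kj].
have [<-|ik'] := eqVneq i k; first exact: connect0.
apply: connect_trans (connect1 eix) (IHp _ px jE _).
move: eix; rewrite /induced_edge coxeter_edge_C => /and3P[_ _ ix].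
by move: ik'; rewrite -val_eqE /= => ik'; lia.
Qed.

Lemma convex_components A b :
  b \in induced_components (@coxeter_matrix_C n) A -> convex b.
Proof.
have R_sym : connect_sym (induced_edge (@coxeter_matrix_C n) A).
  by apply: sym_connect_sym => i j; rewrite /induced_edge coxeter_edge_C_sym andbCA.
case/imsetP=> x xA -> i j k; rewrite !inE => /andP[iA xi] /andP[jA xj] ikj.
have ik : connect (induced_edge (@coxeter_matrix_C n) A) i k.
  apply: connect_induced_between ikj.
  by apply: connect_trans xj; rewrite R_sym.
rewrite (connect_trans xi ik) andbT.
have [<-//|nik] := eqVneq i k.
(* [k] lies in [A] as the end of the last edge of a nonempty walk. *)
case/connectP: ik => p; case/lastP: p => [|p y] /=.
  by move=> _ ki; rewrite ki eqxx in nik.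
by rewrite rcons_path last_rcons => /andP[_ /and3P[_ + _]] ->.
Qed.

(** Splitting at the largest vertex [i] gives the Fibonacci recursion: removing [i], or [i] and its
    predecessor, leaves a convex set. *)
Lemma card_independent_subsets_convex b : convex b ->
  #|independent_subsets e b| = fib #|b|.+2.
Proof.
have [k] := ubnP #|b|; elim: k b => // k IHk b bk cb.
have [->|[i0 i0b]] := set_0Vmem b; first by rewrite card_independent_subsets0 cards0.
pose i := [arg max_(i > i0 in b) (i : nat)].
have [ib imax] : i \in b /\ forall j, j \in b -> j <= i.
  by rewrite /i; case: arg_maxnP.
have cbi : convex (b :\ i).
  move=> x y z; rewrite !inE => /andP[_ xb] /andP[yi yb] xzy.
  rewrite (cb x y z) // andbT; apply: contraNneq yi => zi.
  by rewrite -val_eqE /= eqn_leq imax //= -zi; case/andP: xzy.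
have bE := cardsD1 i b; rewrite ib add1n in bE.
rewrite (card_independent_subsetsD1 coxeter_edge_C_irr coxeter_edge_C_sym ib).
rewrite IHk //; last by rewrite bE in bk.
have [ib1|nib1] := boolP [exists j in b, j.+1 == i :> nat]; last first.
  (* By convexity [b] is then the singleton of [i], with count 1 + 1, which is [fib 3]. *)
  have bi0 : b :\ i = set0.
    apply: contraNeq nib1 => /set0Pn[j]; rewrite !inE -val_eqE /= => /andP[ji jb].
    have ij := imax _ jb; have i1 : i.-1 < n by have := ltn_ord i; lia.
    apply/exists_inP; exists (Ordinal i1); last by rewrite /=; lia.
    by apply: (cb j i) => //=; lia.
  by rewrite bE bi0 set0D card_independent_subsets0 cards0.
case/exists_inP: ib1 => j jb /eqP ji.
have jbi : j \in b :\ i by rewrite !inE jb andbT -val_eqE /=; lia.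
(* As [i] is the largest vertex, [j] is its only neighbour in [b]. *)
have -> : b :\ i :\: [set j | e i j] = b :\ i :\ j.
  apply/setP => x; rewrite !inE coxeter_edge_C -!val_eqE /=.
  case xb: (x \in b); rewrite ?andbF //= !andbT.
  by have := imax _ xb; lia.
rewrite IHk; first by rewrite bE (cardsD1 j (b :\ i)) jbi.
  by rewrite (cardsD1 j (b :\ i)) jbi add1n in bE; lia.
move=> x y z; rewrite !inE => /and3P[_ _ xb] /and3P[yj yi yb] xzy.
have := imax _ yb; move: yj yi; rewrite (cb x y z) // andbT -!val_eqE /=.
by lia.
Qed.

End Path.

Theorem theorem3p6 (n : nat) (hn : (2 <= n)%N)
    (W : groupType) (s : 'I_n -> W)
    (hW : coxeter_system (@coxeter_matrix_C n) s) (v : W) :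
  (boolean_intervals_from s v #=
    `I_(\prod_(b in induced_components (@coxeter_matrix_C n)
                      (~: descents s v)%SET)
          fib (#|b|).+2)%N)%card.
Proof.
have := card_boolean_intervals v (@coxeter_matrix_C_diag n) hW (gen_inj_C hn hW)
  (commute_gen_C hn hW).
rewrite card_independent_subsets_components; last exact: coxeter_edge_C_sym.
rewrite (eq_bigr (fun b : {set 'I_n} => fib #|b|.+2)) // => b /convex_components.
exact: card_independent_subsets_convex.
Qed.
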